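(* Let $X$ and $Y$ be compact subsets of $\mathbb{R}$. There exists an increasing homeomorphism $f\colon\mathbb{R}\to\mathbb{R}$ such that $f[X]=Y$ if and only if there exists an order isomorphism $F\colon \mathcal{A}_X\cup\mathcal{B}_X\to\mathcal{A}_Y\cup\mathcal{B}_Y$ such that $F[\mathcal{A}_X]=\mathcal{A}_Y$.
   Context: For a compact set $X\subseteq\mathbb{R}$: $\mathcal{A}_X$ is the family of all $X$-gaps, i.e. all components of $\mathbb{R}\setminus X$ (including the unbounded ones); $\mathcal{B}_X$ is the family of all $X$-intervals, i.e. all components of $X$ having more than one point. The set $\mathcal{A}_X\cup\mathcal{B}_X$ is linearly ordered by: $I<J$ whenever $x<y$ for all $x\in I$ and $y\in J$. *)

(* Defs.v *)
From mathcomp Require Import all_boot all_order all_algebra.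
From mathcomp Require Import all_classical all_reals all_analysis.

Set Implicit Arguments.
Unset Strict Implicit.
Unset Printing Implicit Defensive.

Import Order.TTheory GRing.Theory Num.Theory.
Import numFieldNormedType.Exports.

Local Open Scope classical_set_scope.
Local Open Scope ring_scope.

Definition homeomorphism (T U : topologicalType) (f : T -> U) : Prop :=
  continuous f /\
  exists g : U -> T, [/\ cancel f g, cancel g f & continuous g].

(* The base points range over [A]: [connected_component A x] is the junk value
   [set0] when [x] is not in [A]. *)
Definition components (T : topologicalType) (A : set T) : set (set T) :=
  connected_component A @` A.

Definition gaps (R : realType) (X : set R) : set (set R) :=
  components (~` X).

Definition nondegenerate_components (R : realType) (X : set R) :
    set (set R) :=
  [set I | components X I /\ exists x y : R, [/\ I x, I y & x <> y]].

Definition set_before (R : realType) (I J : set R) : Prop :=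
  forall x y : R, I x -> J y -> x < y.

(* Only the restriction of [F] to [A] matters. *)
Definition order_isomorphism (T U : Type) (A : set T) (ltA : T -> T -> Prop)
    (B : set U) (ltB : U -> U -> Prop) (F : T -> U) : Prop :=
  set_bij A B F /\
  forall I J : T, A I -> A J -> (ltA I J <-> ltB (F I) (F J)).

(* Main.v *)
(** For the converse, the union of the gaps and nondegenerate components of a
    set is dense in the line, because an open interval missing every gap lies
    in a single nondegenerate component. All nonempty open intervals are order
    isomorphic, and so are all nondegenerate compact intervals; hence [F] lifts
    to an order isomorphism between the two dense unions, by gluing arbitrary
    order isomorphisms [I -> F I]. By completeness this extends to an
    increasing bijection of the line, which is automatically a homeomorphism,
    and it maps [X] onto [Y] because it maps gaps onto gaps. *)

Require Import Defs.
From mathcomp Require Import all_boot all_order all_algebra.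
From mathcomp Require Import all_classical all_reals all_analysis.
From mathcomp Require Import ring lra.

Set Implicit Arguments.
Unset Strict Implicit.
Unset Printing Implicit Defensive.

Import Order.TTheory GRing.Theory Num.Theory.
Import numFieldNormedType.Exports.

Local Open Scope classical_set_scope.
Local Open Scope ring_scope.

(** * Order equivalence of subsets of the line *)

Definition order_dense (R : realType) (D : set R) : Prop :=
  forall x y : R, x < y -> exists2 d, D d & x < d < y.

Definition increasing_on (R : realType) (A : set R) (g : R -> R) : Prop :=
  forall x y, A x -> A y -> x < y -> g x < g y.

(** The witness is a total function, arbitrary off [A]; its inverse is recovered from strict
    monotonicity. *)
Definition order_equivalent (R : realType) (A B : set R) : Prop :=
  exists g : R -> R, increasing_on A g /\ g @` A = B.

Lemma increasing_on_reflect (R : realType) (A : set R) (g : R -> R) (x y : R) :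
  increasing_on A g -> A x -> A y -> g x < g y -> x < y.
Proof.
move=> gi Ax Ay gxy; case: (ltgtP x y) => // [yx|xy].
  by have := lt_trans gxy (gi _ _ Ay Ax yx); rewrite ltxx.
by move: gxy; rewrite xy ltxx.
Qed.

Lemma increasing_on_le (R : realType) (A : set R) (g : R -> R) (x y : R) :
  increasing_on A g -> A x -> A y -> x <= y -> g x <= g y.
Proof.
move=> gi Ax Ay; case: (ltgtP x y) => // [xy _|-> _ //].
exact/ltW/gi.
Qed.

Lemma order_equivalent_sym (R : realType) (A B : set R) :
  order_equivalent A B -> order_equivalent B A.
Proof.
move=> [g [gi <-]].
(* [h] picks a preimage in [A] for each point of the image; elsewhere its value is arbitrary. *)
have /choice[h hP] : forall y, exists x, (g @` A) y -> A x /\ g x = y.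
  move=> y; have [[x Ax gx]|nB] := pselect ((g @` A) y); first by exists x.
  by exists 0.
exists h; split=> [x y Bx By xy|].
  have [[Ahx ghx] [Ahy ghy]] := (hP x Bx, hP y By).
  by apply: (increasing_on_reflect gi) => //; rewrite ghx ghy.
apply/seteqP; split=> [_ [y /hP[Ahy _] <-]//|x Ax].
exists (g x); first by exists x.
have [|Ah gh] := hP (g x); first by exists x.
case: (ltgtP (h (g x)) x) => // lt.
  by have := gi _ _ Ah Ax lt; rewrite gh ltxx.
by have := gi _ _ Ax Ah lt; rewrite gh ltxx.
Qed.

Lemma order_equivalent_trans (R : realType) (A B C : set R) :
  order_equivalent A B -> order_equivalent B C -> order_equivalent A C.
Proof.
move=> [g [gi <-]] [h [hi <-]]; exists (h \o g); split.
  by move=> x y Ax Ay xy; apply: hi; [exists x|exists y|exact: gi].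
by rewrite image_comp.
Qed.

(** * Increasing bijections of the line and extension from dense sets *)

Lemma increasing_onto_continuous (R : realType) (f g : R -> R) :
  {homo f : x y / x < y} -> {homo g : x y / x < y} ->
  cancel f g -> cancel g f -> continuous f.
Proof.
move=> fi gi fK gK x; apply/cvgrPdist_lt => e e0.
(* The open interval from [g (f x - e)] to [g (f x + e)] contains [x], and [f] maps it into the
   [e]-ball around [f x]. *)
have xl : g (f x - e) < x by rewrite -[ltRHS]fK; apply: gi; lra.
have xr : x < g (f x + e) by rewrite -[ltLHS]fK; apply: gi; lra.
have : nbhs x [set` `]g (f x - e), g (f x + e)[].
  by apply: open_nbhs_nbhs; split; [exact: itv_open|rewrite /= in_itv/= xl].
apply: filterS => t; rewrite /= in_itv/= => /andP[/fi + /fi].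
rewrite !gK => tl tr; rewrite ltr_norml; lra.
Qed.

(** A strictly increasing [f] is injective and reflects the order. So a right inverse obtained by
    choice is two-sided and increasing, and the continuity argument applies to both maps. *)
Lemma increasing_surjection_homeomorphism (R : realType) (f : R -> R) :
  {homo f : x y / x < y} -> (forall y, exists x, f x = y) -> homeomorphism f.
Proof.
move=> fi /choice[g gK].
have fm : {mono f : x y / x < y} by apply/leW_mono/le_mono.
have fK : cancel f g.
  by move=> x; apply: (inc_inj (le_mono fi)); rewrite gK.
have gi : {homo g : x y / x < y} by move=> x y xy; rewrite -fm !gK.
split; first exact: (increasing_onto_continuous fi gi).
by exists g; split=> //; exact: (increasing_onto_continuous gi fi).
Qed.

(** Take [f x] to be the supremum of the values of [g] at points of [D] up to [x]. Density of [D]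
    makes these suprema finite and [f] strictly increasing; density of [E] rules out jumps, so [f]
    is onto. *)
Lemma increasing_on_dense_extension (R : realType) (D E : set R) (g : R -> R) :
  order_dense D -> order_dense E -> increasing_on D g -> g @` D = E ->
  exists f : R -> R, [/\ {homo f : x y / x < y},
    (forall y, exists x, f x = y) & forall d, D d -> f d = g d].
Proof.
move=> dD dE gi gDE.
pose below x := [set g d | d in [set d | D d /\ d <= x]].
have below0 x : below x !=set0.
  have [|d Dd /andP[_ dx]] := dD (x - 1) x; first by lra.
  by exists (g d), d => //; split => //; exact: ltW.
have belowU x d : D d -> x <= d -> ubound (below x) (g d).
  move=> Dd xd _ [d' [Dd' d'x] <-].
  exact: increasing_on_le gi Dd' Dd (le_trans d'x xd).
have belowS x : has_sup (below x).
  split=> //; have [|d Dd /andP[xd _]] := dD x (x + 1); first by lra.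
  by exists (g d); apply: belowU => //; exact: ltW.
pose f x := sup (below x).
have fle x d : D d -> x <= d -> f x <= g d.
  by move=> Dd xd; apply: ge_sup => //; exact: belowU.
have fge x d : D d -> d <= x -> g d <= f x.
  by move=> Dd dx; apply: ub_le_sup; [exact: (belowS x).2|exists d].
have fi : {homo f : x y / x < y}.
  (* Two points of [D] between [x] and [y] are taken: [fle] and [fge] are weak bounds, and
     strictness comes from [g d < g d']. *)
  move=> x y xy; have [d Dd /andP[xd dy]] := dD _ _ xy.
  have [d' Dd' /andP[dd' d'y]] := dD _ _ dy.
  apply: (le_lt_trans (fle _ _ Dd (ltW xd))).
  by apply: (lt_le_trans (gi _ _ Dd Dd' dd')); apply: fge => //; exact: ltW.
have fD d : D d -> f d = g d.
  by move=> Dd; apply/eqP; rewrite eq_le fle// fge.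
exists f; split=> // y.
(* The preimage of [y] will be [sup S]; density of [E] near [y] makes [S] nonempty and bounded
   above. *)
pose S := [set d | D d /\ g d <= y].
have gE e : E e -> exists2 d, D d & g d = e by rewrite -gDE.
have S0 : S !=set0.
  have [|_ /gE[d Dd <-] /andP[_ dy]] := dE (y - 1) y; first by lra.
  by exists d; split=> //; exact: ltW.
have SU : has_ubound S.
  have [|_ /gE[u Du <-] /andP[yu _]] := dE y (y + 1); first by lra.
  exists u => d [Dd gdy]; apply/ltW/(increasing_on_reflect gi Dd Du).
  exact: le_lt_trans yu.
have fm : {mono f : x y / x < y} by apply/leW_mono/le_mono.
(* If [f (sup S)] differed from [y], some value [g d] would lie strictly between them. Then [d]
   would be an element of [S] above its supremum, or an upper bound of [S] below it. *)
exists (sup S); case: (ltgtP (f (sup S)) y) => // [lt|lt].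
- have [_ /gE[d Dd <-] /andP[]] := dE _ _ lt.
  rewrite -fD// fm fD// => Sd dy.
  have : d <= sup S by apply: ub_le_sup => //; split=> //; exact: ltW.
  by rewrite leNgt Sd.
- have [_ /gE[d Dd <-] /andP[yd]] := dE _ _ lt.
  rewrite -fD// fm => /sup_gt[//|d' [Dd' d'y] /(gi _ _ Dd Dd')].
  by rewrite ltNge (le_trans d'y (ltW yd)).
Qed.

(** * Order types of open intervals and of compact intervals *)

Lemma open_interval_order_equivalent (R : realType) (I : set R) :
  open I -> is_interval I -> I !=set0 -> order_equivalent I [set r | 0 < r].
Proof.
(* As [I] is its own interior, the description of the interior of an interval by its bounds
   describes [I] itself. The four cases follow which bounds exist. *)
move=> oI iI I0; have IE := (interior_id I).1 oI.
have [lb|nlb] := pselect (has_lbound I); have [ub|nub] := pselect (has_ubound I).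
- have {}IE := etrans (esym IE) (interval_bounded_interior iI lb ub).
  have [c Ic] := I0; move: Ic; rewrite IE; set a := inf I; set b := sup I.
  rewrite /= => /andP[ac cb].
  exists (fun x => (x - a) / (b - x)); split.
    move=> x y /= /andP[ax xb] /andP[ay yb] xy.
    rewrite ltr_pdivrMr; last by lra.
    rewrite mulrAC ltr_pdivlMr; last by lra.
    by nra.
  apply/seteqP; split=> [_ [x /= /andP[ax xb] <-]|y /= y0].
    by apply: divr_gt0; lra.
  have y1 : 0 < 1 + y by lra.
  (* This is the solution [x] of [(x - a) / (b - x) = y]. *)
  exists ((a + b * y) / (1 + y)).
    by rewrite /= ltr_pdivlMr// ltr_pdivrMr//; apply/andP; split; nra.
  have -> : (a + b * y) / (1 + y) - a = (b - a) * y / (1 + y) by field; exact: lt0r_neq0.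
  have -> : b - (a + b * y) / (1 + y) = (b - a) / (1 + y) by field; exact: lt0r_neq0.
  by field; rewrite !lt0r_neq0//; lra.
- have {}IE := etrans (esym IE) (interval_right_unbounded_interior iI lb nub).
  rewrite IE; exists (fun x => x - inf I); split=> [x y _ _|].
    by rewrite ltrD2r.
  apply/seteqP; split=> [_ [x /= ax <-]|y /= y0]; first by rewrite subr_gt0.
  by exists (y + inf I); rewrite ?addrK//= ltrDr.
- have {}IE := etrans (esym IE) (interval_left_unbounded_interior iI nlb ub).
  rewrite IE; exists (fun x => (sup I - x)^-1); split=> [x y /= xb yb xy|].
    by rewrite ltf_pV2 ?posrE; lra.
  apply/seteqP; split=> [_ [x /= ax <-]|y /= y0].
    by rewrite invr_gt0 subr_gt0.
  exists (sup I - y^-1); last by rewrite subKr invrK.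
  by rewrite /= ltrBlDr ltrDl invr_gt0.
- rewrite (interval_unbounded_setT iI)//; exists expR; split.
    by move=> x y _ _; rewrite ltr_expR.
  apply/seteqP; split=> [_ [x _ <-]|y /= y0]; first exact: expR_gt0.
  by exists (ln y) => //; rewrite lnK.
Qed.

(** By compactness the identity attains a minimum [a] and a maximum [b] on [I], so [I] is the
    segment from [a] to [b]. Two distinct points force [a < b], and an affine map rescales to the
    unit segment. *)
Lemma compact_interval_order_equivalent (R : realType) (I : set R) :
  compact I -> is_interval I -> (exists x y, [/\ I x, I y & x <> y]) ->
  order_equivalent I [set r | 0 <= r <= 1].
Proof.
move=> cI iI [u [v [Iu Iv uv]]].
have I0 : I !=set0 by exists u.
have idc : {within I, continuous id} by apply: continuous_subspaceT => x; exact: cvg_id.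
have [a /[!inE] Ia amin] := compact_EVT_min I0 cI idc.
have [b /[!inE] Ib bmax] := compact_EVT_max I0 cI idc.
have IE : I = [set x | a <= x <= b].
  apply/seteqP; split=> [x Ix|x /=]; last exact: iI.
  by rewrite /= amin ?bmax ?inE.
have ab : a < b.
  rewrite lt_neqAle amin ?inE// andbT; apply/eqP => ab; apply: uv.
  by move: Iu Iv; rewrite IE/= ab => /le_anti <- /le_anti <-.
move: IE => ->; exists (fun x => (x - a) / (b - a)); split=> [x y _ _ xy|].
  by rewrite ltr_pM2r ?invr_gt0; lra.
apply/seteqP; split=> [_ [x /= /andP[ax xb] <-]|y /= /andP[y0 y1]].
  by rewrite ler_pdivlMr ?ler_pdivrMr; lra.
exists (a + y * (b - a)); first by nra.
by field; apply: lt0r_neq0; lra.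
Qed.

(** * Gaps and nondegenerate components *)

Lemma components_eq (T : topologicalType) (A I : set T) (x : T) :
  components A I -> I x -> A x /\ I = connected_component A x.
Proof.
move=> [y Ay <-] yx; split; first exact: connected_component_sub yx.
exact: same_connected_component.
Qed.

Lemma components_is_interval (R : realType) (A I : set R) :
  components A I -> is_interval I.
Proof. by move=> [x _ <-]; apply/connected_intervalP/component_connected. Qed.

(** A ball inside [A] around a point of a component is an interval, hence connected, so the
    component absorbs it. *)
Lemma components_open (R : realType) (A I : set R) :
  open A -> components A I -> open I.
Proof.
move=> oA AI; rewrite openE => x Ix.
have [Ax ->] := components_eq AI Ix.
have [e /= e0 eA] : nbhs_ball x A by rewrite nbhs_ballE; exact: open_nbhs_nbhs.
rewrite /interior -nbhs_ballE; exists e => //=.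
apply: connected_component_max => //; first exact: ballxx.
by apply/connected_intervalP; rewrite ball_itv; exact: interval_is_interval.
Qed.

(** The set $\mathcal{A}_X\cup\mathcal{B}_X$. *)
Definition pieces (R : realType) (X : set R) : set (set R) :=
  gaps X `|` nondegenerate_components X.

Lemma pieces_is_interval (R : realType) (X I : set R) :
  pieces X I -> is_interval I.
Proof. by case=> [|[+ _]]; exact: components_is_interval. Qed.

(** Two components of the same set that share a point coincide, and a gap cannot share a point with
    a component of [X]. *)
Lemma pieces_disjoint (R : realType) (X I J : set R) (x : R) :
  pieces X I -> pieces X J -> I x -> J x -> I = J.
Proof.
move=> [XI|[XI _]] [XJ|[XJ _]] Ix Jx;
  have [+ ->] := components_eq XI Ix; have [+ ->] := components_eq XJ Jx => //.
Qed.

Lemma gaps_nondegenerate_disjoint (R : realType) (X I : set R) :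
  gaps X I -> ~ nondegenerate_components X I.
Proof.
move=> XI [XI' [x [_ [Ix _ _]]]].
by have [+ _] := components_eq XI Ix; have [+ _] := components_eq XI' Ix.
Qed.

Lemma gaps_cover (R : realType) (X : set R) (x : R) :
  ~ X x -> exists2 I, gaps X I & I x.
Proof.
move=> nXx; exists (connected_component (~` X) x); first by exists x.
exact: connected_component_refl.
Qed.

Lemma pieces_order_dense (R : realType) (X : set R) :
  order_dense (\bigcup_(I in pieces X) I).
Proof.
move=> x y xy.
have [[z zxy nXz]|nX] := pselect (exists2 z, x < z < y & ~ X z).
  have [I XI Iz] := gaps_cover nXz.
  by exists z => //; exists I => //; left.
have subX : [set` `]x, y[] `<=` X.
  move=> z; rewrite /= in_itv/= => zxy; apply: contrapT => nXz.
  by apply: nX; exists z.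
(* The component of the midpoint [m] contains the whole open interval; [n] is a second point showing
   that it is nondegenerate. *)
pose m := (x + y) / 2; pose n := (x + m) / 2.
have mxy : x < m < y by rewrite /m; lra.
have nxy : x < n < y by rewrite /n; lra.
have sub : [set` `]x, y[] `<=` connected_component X m.
  apply: connected_component_max => //.
  by apply/connected_intervalP; exact: interval_is_interval.
exists m => //; exists (connected_component X m); last exact: sub.
right; split; first by exists m => //; exact: subX.
exists m, n; split; [exact: sub|exact: sub|].
by rewrite /n; lra.
Qed.

(** Gaps of a closed set are nonempty open intervals, so the positive half-line is a common model
    for them. *)
Lemma gaps_order_equivalent (R : realType) (X Y I J : set R) :
  closed X -> closed Y -> gaps X I -> gaps Y J -> order_equivalent I J.
Proof.
have gap_pos (Z K : set R) :
    closed Z -> gaps Z K -> order_equivalent K [set r | 0 < r].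
  move=> cZ ZK; apply: open_interval_order_equivalent.
  - by apply: components_open ZK; exact: closed_openC.
  - exact: components_is_interval ZK.
  - by move: ZK => [x Zx <-]; exists x; exact: connected_component_refl.
move=> cX cY XI YJ; apply: order_equivalent_trans (gap_pos _ _ cX XI) _.
exact/order_equivalent_sym/(gap_pos _ _ cY YJ).
Qed.

(** A component of a compact set is closed in it, hence compact, so the unit segment is a common
    model. *)
Lemma nondegenerate_order_equivalent (R : realType) (X Y I J : set R) :
  compact X -> compact Y ->
  nondegenerate_components X I -> nondegenerate_components Y J ->
  order_equivalent I J.
Proof.
have seg (Z K : set R) : compact Z -> nondegenerate_components Z K ->
    order_equivalent K [set r | 0 <= r <= 1].
  move=> cZ [ZK K2]; apply: compact_interval_order_equivalent => //.
    move: ZK => [x Zx <-].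
    apply: (subclosed_compact _ cZ); last exact: connected_component_sub.
    by apply: component_closed; apply: compact_closed => //; exact: Rhausdorff.
  exact: components_is_interval ZK.
move=> cX cY XI YJ; apply: order_equivalent_trans (seg _ _ cX XI) _.
exact/order_equivalent_sym/(seg _ _ cY YJ).
Qed.

(** * Gluing order equivalences along an order isomorphism *)

Lemma set_before_disjoint (R : realType) (I J : set R) (x y : R) :
  is_interval I -> is_interval J -> (forall z, I z -> ~ J z) ->
  I x -> J y -> x < y -> set_before I J.
Proof.
move=> iI iJ IJ Ix Jy xy u v Iu Jv; rewrite ltNge; apply/negP => vu.
(* Given [v <= u], either [x <= v <= u] puts [v] in [I], or [v < x < y] puts [x] in [J]; both
   contradict disjointness. *)
have [xv|vx] := leP x v.
  by apply: (IJ v) => //; apply: (iI x u); rewrite ?xv.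
by apply: (IJ x) => //; apply: (iJ v y); rewrite ?ltW.
Qed.

(** On each member [I] the map is a chosen order equivalence onto [F I]. Points of distinct members
    compare correctly because disjoint intervals are ordered by [set_before], which [F]
    preserves. *)
Lemma increasing_on_glue (R : realType) (P Q : set (set R))
    (F : set R -> set R) :
  (forall I, P I -> is_interval I) ->
  (forall I J x, P I -> P J -> I x -> J x -> I = J) ->
  order_isomorphism P (@set_before R) Q (@set_before R) F ->
  (forall I, P I -> order_equivalent I (F I)) ->
  exists g : R -> R, increasing_on (\bigcup_(I in P) I) g /\
    forall I, P I -> g @` I = F I.
Proof.
move=> Pi Pd [_ Flt] Fe.
have /choice[phi phiP] : forall I, exists g, P I ->
    increasing_on I g /\ g @` I = F I.
  move=> I; have [/Fe[g gP]|nP] := pselect (P I); first by exists g.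
  by exists id.
(* [K x] is the member containing [x], unique by disjointness; off the union it is arbitrary. *)
have /choice[K KP] : forall x, exists I, (\bigcup_(I in P) I) x -> P I /\ I x.
  move=> x; have [[I PI Ix]|nU] := pselect ((\bigcup_(I in P) I) x).
    by exists I.
  by exists set0.
have KE I x : P I -> I x -> K x = I.
  move=> PI Ix; have [|PK Kx] := KP x; first by exists I.
  exact: Pd Kx Ix.
exists (fun x => phi (K x) x); split=> [x y [I PI Ix] [J PJ Jy] xy|I PI].
  rewrite (KE I)// (KE J)//.
  have [IJ|IJ] := pselect (I = J).
    by rewrite IJ in Ix *; apply: (phiP _ PJ).1.
  have /Flt : set_before I J.
    apply: (set_before_disjoint (Pi _ PI) (Pi _ PJ) _ Ix Jy xy) => z Iz Jz.
    exact: IJ (Pd _ _ _ PI PJ Iz Jz).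
  apply=> //; rewrite -?(phiP _ PI).2 -?(phiP _ PJ).2; first by exists x.
  by exists y.
rewrite -(phiP _ PI).2; apply: eq_imagel => x Ix.
by rewrite (KE I).
Qed.

(** * From the order isomorphism to the homeomorphism *)

Lemma pieces_isomorphism_homeomorphism (R : realType) (X Y : set R)
    (F : set R -> set R) :
  compact X -> compact Y ->
  order_isomorphism (pieces X) (@set_before R) (pieces Y) (@set_before R) F ->
  F @` gaps X = gaps Y ->
  exists f : R -> R,
    [/\ homeomorphism f, {homo f : x y / x < y} & f @` X = Y].
Proof.
move=> cX cY Fiso Fgap; have [[FP Finj Fsurj] _] := Fiso.
have clR (Z : set R) : compact Z -> closed Z.
  by move=> cZ; apply: compact_closed => //; exact: Rhausdorff.
have FgapX I : gaps X I -> gaps Y (F I) by rewrite -Fgap => XI; exists I.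
have Fe I : pieces X I -> order_equivalent I (F I).
  move=> PI; case: (PI) => [XI|XI].
    by apply: (gaps_order_equivalent (clR _ cX) (clR _ cY)) => //; exact: FgapX.
  apply: (nondegenerate_order_equivalent cX cY) => //.
  (* Were [F I] a gap, it would be [F J] for some gap [J]; injectivity of [F] would then make the
     nondegenerate component [I] itself a gap. *)
  case: (FP _ PI) => //; rewrite -Fgap => -[J XJ FJI].
  have JI : J = I by apply: Finj => //; rewrite inE //; left.
  by have := gaps_nondegenerate_disjoint XJ; rewrite JI.
have [g [gi gF]] := increasing_on_glue (@pieces_is_interval R X)
  (@pieces_disjoint R X) Fiso Fe.
have gU : g @` (\bigcup_(I in pieces X) I) = \bigcup_(J in pieces Y) J.
  apply/seteqP; split=> [_ [x [I PI Ix] <-]|y [J /Fsurj[I PI <-]]].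
    by exists (F I); [exact: FP|rewrite -gF//; exists x].
  by rewrite -gF// => -[x Ix <-]; exists x => //; exists I.
have [f [fi fsurj fg]] := increasing_on_dense_extension
  (@pieces_order_dense R X) (@pieces_order_dense R Y) gi gU.
have fF I : gaps X I -> f @` I = F I.
  move=> XI; rewrite -gF; last by left.
  by apply: eq_imagel => x Ix; apply: fg; exists I => //; left.
have finj : injective f by apply: inc_inj; exact: le_mono.
exists f; split=> //; first exact: increasing_surjection_homeomorphism.
(* Both inclusions pass to complements: a point off [X] or [Y] lies in a gap, and [f] maps each gap
   [I] of [X] onto the gap [F I] of [Y]. *)
apply/seteqP; split=> [_ [x Xx <-]|y Yy].
  apply: contrapT => /gaps_cover[J]; rewrite -Fgap => -[I XI <-].
  rewrite -fF// => -[z Iz /finj zx]; rewrite zx in Iz.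
  by have [+ _] := components_eq XI Iz.
have [x fx] := fsurj y; exists x => //; apply: contrapT => /gaps_cover[I XI Ix].
have : F I y by rewrite -fF//; exists x.
by move=> /(components_eq (FgapX _ XI))[].
Qed.

(** * From the homeomorphism to the order isomorphism *)

Lemma continuous_image_component (T U : topologicalType) (f : T -> U)
    (A : set T) (x : T) : continuous f -> A x ->
  f @` connected_component A x `<=` connected_component (f @` A) (f x).
Proof.
move=> fc Ax; apply: connected_component_max.
- by exists x => //; exact: connected_component_refl.
- by apply: image_subset; exact: connected_component_sub.
- apply: connected_continuous_connected; first exact: component_connected.
  by apply: continuous_subspaceT => y; exact: fc.
Qed.

(** Continuity gives only an inclusion between the image of a component and a component of the
    image; applying it to the inverse as well gives equality. *)
Lemma homeomorphism_components (T U : topologicalType) (f : T -> U)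
    (A : set T) : homeomorphism f ->
  components (f @` A) = image^~ f @` components A.
Proof.
move=> [fc [g [fK gK gc]]].
have E x : A x ->
    f @` connected_component A x = connected_component (f @` A) (f x).
  move=> Ax; apply/seteqP; split; first exact: continuous_image_component.
  have fAfx : (f @` A) (f x) by exists x.
  have := continuous_image_component gc fAfx.
  rewrite image_comp (eq_imagel (f' := id)) ?image_id; last first.
    by move=> z _ /=; rewrite fK.
  rewrite fK => sub y Cy; exists (g y) => //.
  by apply: sub; exists y.
apply/seteqP; split=> [_ [_ [x Ax <-] <-]|_ [_ [x Ax <-] <-]].
  by exists (connected_component A x); [exists x|exact: E].
by exists (f x); [exists x|rewrite -E].
Qed.

Lemma homeomorphism_gaps (R : realType) (f : R -> R) (X : set R) :
  homeomorphism f -> gaps (f @` X) = image^~ f @` gaps X.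
Proof.
move=> fh; rewrite /gaps -homeomorphism_components//; congr components.
have [_ [g [fK gK _]]] := fh.
apply/seteqP; split=> [y nfX|_ [x nX <-] [z Xz /(can_inj fK) zx]].
  by exists (g y) => // Xgy; apply: nfX; exists (g y).
by apply: nX; rewrite -zx.
Qed.

Lemma homeomorphism_nondegenerate_components (R : realType) (f : R -> R)
    (X : set R) : homeomorphism f ->
  nondegenerate_components (f @` X) = image^~ f @` nondegenerate_components X.
Proof.
move=> fh; have [_ [g [fK _ _]]] := fh.
rewrite /nondegenerate_components homeomorphism_components//.
apply/seteqP; split=> [_ [[I XI <-] [_ [_ [[x Ix <-] [y Iy <-] xy]]]]|].
  exists I => //; split=> //; exists x, y; split=> // E.
  by apply: xy; rewrite E.
move=> _ [I [XI [x [y [Ix Iy xy]]]] <-]; split; first by exists I.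
exists (f x), (f y); split; [by exists x|by exists y|].
by move=> /(can_inj fK).
Qed.

(** Direct image under [f] carries pieces onto pieces. It is injective on sets since [f] is
    injective, and it respects [set_before] in both directions since [f] preserves and reflects the
    order. *)
Lemma increasing_homeomorphism_pieces (R : realType) (f : R -> R) (X : set R) :
  homeomorphism f -> {homo f : x y / x < y} ->
  order_isomorphism (pieces X) (@set_before R)
    (pieces (f @` X)) (@set_before R) (image^~ f).
Proof.
move=> fh fi.
have fm : {mono f : x y / x < y} by apply/leW_mono/le_mono.
have finj : injective f by apply: inc_inj; exact: le_mono.
have -> : pieces (f @` X) = image^~ f @` pieces X.
  by rewrite /pieces image_setU homeomorphism_gaps//
    homeomorphism_nondegenerate_components.
split.
  split=> [I PI|I J _ _ IJ|//]; first by exists I.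
  by apply/funext => x; rewrite -(image_inj finj) IJ image_inj.
move=> I J _ _; split=> IJ.
  by move=> _ _ [x Ix <-] [y Jy <-]; apply/fi/IJ.
by move=> x y Ix Jy; rewrite -fm; apply: IJ; [exists x|exists y].
Qed.

Theorem proposition10 (R : realType) (X Y : set R)
    (cX : compact X) (cY : compact Y) :
  (exists f : R -> R,
      [/\ homeomorphism f, {homo f : x y / x < y} & f @` X = Y])
  <->
  (exists F : set R -> set R,
      order_isomorphism (gaps X `|` nondegenerate_components X) (@set_before R)
                        (gaps Y `|` nondegenerate_components Y) (@set_before R)
                        F
      /\ F @` gaps X = gaps Y).
Proof.
split=> [[f [fh fi <-]]|[F [Fiso Fgap]]].
  exists (image^~ f); split; first exact: increasing_homeomorphism_pieces.
  exact/esym/homeomorphism_gaps.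
exact: pieces_isomorphism_homeomorphism Fgap.
Qed.
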